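(* Let $B\subset\mathbb R^n$ be an $n$-dimensional (closed) ball and, for $i=1,\ldots,n+1$, let $f_i$ be a set-valued map assigning to each $x\in B$ a nonempty subset $f_i(x)\subseteq B$, such that the graph $\{(x,y)\in B\times B: y\in f_i(x)\}$ is closed in $B\times B$. Then there exists $x\in B$ with $x\in f_1(x)*f_2(x)*\cdots*f_{n+1}(x)$.
   Context: For subsets $A_1,\ldots,A_m$ of $\mathbb R^n$, the geometric join $A_1*\cdots*A_m$ is the set of all convex combinations $t_1a_1+\cdots+t_ma_m$ with $a_i\in A_i$, $t_i\ge0$, $\sum_i t_i=1$. *)

(* Defs.v *)
From HB Require Import structures.
From mathcomp Require Import all_boot all_order all_algebra.
From mathcomp Require Import all_classical all_reals all_analysis.
Set Implicit Arguments. Unset Strict Implicit. Unset Printing Implicit Defensive.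
Import Order.TTheory GRing.Theory Num.Theory.
Import numFieldNormedType.Exports.
Local Open Scope classical_set_scope.
Local Open Scope ring_scope.

Definition eball {R : realType} {n : nat} (c : 'rV[R]_n) (r : R) : set 'rV[R]_n :=
  [set x | \sum_(j < n) (x ord0 j - c ord0 j) ^+ 2 <= r ^+ 2].

Definition gjoin {R : realType} {n m : nat} (A : 'I_m -> set 'rV[R]_n)
  : set 'rV[R]_n :=
  [set z | exists (t : 'I_m -> R) (a : 'I_m -> 'rV[R]_n),
     (forall i, 0 <= t i) /\ \sum_(i < m) t i = 1 /\
     (forall i, A i (a i)) /\ z = \sum_(i < m) t i *: a i].

Definition sgraph {R : realType} {n : nat} (B : set 'rV[R]_n)
  (f : 'rV[R]_n -> set 'rV[R]_n) : set ('rV[R]_n * 'rV[R]_n) :=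
  [set p | B p.1 /\ B p.2 /\ f p.1 p.2].

(* Main.v *)
Require Import Defs.
From HB Require Import structures.
From mathcomp Require Import all_boot all_order all_algebra.
From mathcomp Require Import all_classical all_reals all_analysis.
From mathcomp Require Import zify ring lra.
Set Implicit Arguments. Unset Strict Implicit. Unset Printing Implicit Defensive.
Import Order.TTheory GRing.Theory Num.Theory.
Import numFieldNormedType.Exports.

(* The idea is to apply Brouwer's theorem to averaged selections that are
   rainbow on small cells.  Put a grid of mesh L/p on a cube around the
   ball; the hat functions of the Kuhn triangulation have the property that the
   grid points v whose hats are positive at a given x are within L/p of x and
   have pairwise distinct colours sum v mod (n+1).  Choosing for each v of colour
   i a value g(v) in f_i (at v retracted to the ball) and averaging the g(v) with
   the normalized hats gives a continuous self-map of the cube; at a fixed point,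
   x is a convex combination of at most one g(v) per colour.  Letting p tend to
   infinity, compactness and the closed graphs yield the theorem.

   Brouwer's theorem on a cube comes from Kuhn's cubical Sperner lemma, proved
   modulo 2: for 0-cochains h_j of the grid equal to 0 on x_j = 0 and to 1 on
   x_j = p, the cup product dh_1 u ... u dh_n is a coboundary, so its sum over
   all cells reduces to faces, and by induction on dimension it equals 1; a cell
   on which it does not vanish sees both values of every h_j. *)

Local Open Scope ring_scope.

(** * Kuhn's cubical lemma *)

Lemma F2_addrr (z : 'F_2) : z + z = 0.
Proof. by apply/val_inj; case: z => [[|[|]]]. Qed.

Lemma F2_eq_add (y z : 'F_2) : y + z = 0 -> y = z.
Proof. by move=> yz; rewrite -[y]addr0 -(F2_addrr z) addrA yz add0r. Qed.

Section Kuhn.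
Variable n : nat.
Implicit Types (J : {set 'I_n}).

(** As [A] runs over the subsets of [J], [shift A x] runs over the vertices of the unit cube at [x]
    with directions [J]. *)
Definition shift J (x : {ffun 'I_n -> nat}) : {ffun 'I_n -> nat} :=
  [ffun i => (x i + (i \in J))%N].

Definition upd j m (x : {ffun 'I_n -> nat}) : {ffun 'I_n -> nat} :=
  [ffun i => if i == j then m else x i].

(** The terms at (i, j) and (j, i) agree, so they cancel modulo 2. *)
Lemma sum_symm_F2 J (F : 'I_n -> 'I_n -> 'F_2) :
  (forall i j, F i j = F j i) -> \sum_(i in J) \sum_(j in J :\ i) F i j = 0.
Proof.
move=> FC.
have E i : \sum_(j in J :\ i) F i j =
   \sum_(j in J | (j < i)%N) F i j + \sum_(j in J | (i < j)%N) F i j.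
  rewrite (bigID (fun j : 'I_n => (j < i)%N)) /=; congr (_ + _).
    apply: eq_bigl => j; rewrite !inE; case: (ltnP j i); rewrite ?andbF // andbT => h.
    by rewrite andbT -val_eqE /= neq_ltn h.
  apply: eq_bigl => j; rewrite !inE -val_eqE /=.
  by case: (ltngtP j i); rewrite ?andbF ?andbT.
rewrite (eq_bigr _ (fun i _ => E i)) big_split /=.
rewrite [X in _ + X](exchange_big_dep (mem J)) /=; last by move=> i j _ /andP[].
rewrite [X in _ + X](_ : _ = \sum_(i in J) \sum_(j in J | (j < i)%N) F i j) ?F2_addrr //.
by apply: eq_bigr => i iJ; apply: eq_big => [j|j _]; rewrite ?iJ.
Qed.

Variable h : nat -> {ffun 'I_n -> nat} -> 'F_2.

(* [cup k J x] evaluates the cubical cup product dh_0 u ... u dh_(k-1), modulo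
   2, at the |J|-dimensional unit cube with lowest vertex [x] and directions
   [J] (|J| = k in all uses that matter). *)
Fixpoint cup k J (x : {ffun 'I_n -> nat}) : 'F_2 :=
  if k is k'.+1 then
    \sum_(j in J) cup k' (J :\ j) x * (h k' (shift J x) + h k' (shift (J :\ j) x))
  else 1.

Lemma shiftD1 J j x : j \in J -> shift (J :\ j) (shift [set j] x) = shift J x.
Proof.
move=> jJ; apply/ffunP => i; rewrite !ffunE !inE -addnA.
by case: eqP => [->|]; rewrite ?jJ.
Qed.

(** A cup product of coboundaries is a cocycle: the far and near faces of a cube have equal sums. In
    the induction on [k], the sum over far faces of a far face is moved back to [x] by the induction
    hypothesis. *)
Lemma cup_closed k J x :
  \sum_(j in J) cup k (J :\ j) (shift [set j] x) = \sum_(j in J) cup k (J :\ j) x.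
Proof.
elim: k J x => [//|k IH] J x /=.
rewrite (exchange_big_dep (mem J)) /=; last by move=> j i _; rewrite inE => /andP[].
have E i : i \in J -> \sum_(j in J | i \in J :\ j)
    cup k (J :\ j :\ i) (shift [set j] x) *
    (h k (shift (J :\ j) (shift [set j] x)) + h k (shift (J :\ j :\ i) (shift [set j] x)))
  = \sum_(j in J :\ i) cup k (J :\ i :\ j) x * (h k (shift J x) + h k (shift (J :\ i) x)).
  move=> iJ; rewrite -big_distrl -IH big_distrl /=.
  apply: eq_big => [j|j]; first by rewrite !inE iJ andbT andbC eq_sym.
  move=> /andP[jJ]; rewrite !inE iJ andbT => ij.
  rewrite (shiftD1 _ jJ) finset.setDDl [_ :|: _]finset.setUC -finset.setDDl shiftD1 //.
  by rewrite !inE eq_sym ij.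
(* When both sides are added, the values of [h k] at [shift (J :\ i) x] cancel; what remains is
   symmetric in i and j. *)
rewrite (eq_bigr _ E); apply: F2_eq_add; rewrite -big_split /=.
under eq_bigr => i _ do rewrite -big_split /=.
under eq_bigr => i _.
  under eq_bigr => j _.
    rewrite -mulrDr [X in X + _]addrC addrACA F2_addrr add0r.
    over.
  over.
apply: sum_symm_F2 => i j.
by rewrite finset.setDDl [_ :|: _]finset.setUC -finset.setDDl.
Qed.

(** Leibniz rule: since dh_0 u ... u dh_(k-1) is closed, multiplying it by dh_k gives the coboundary
    of its product with h_k, that is, a sum over the faces of the cube. *)
Lemma cupS k J x : cup k.+1 J x =
  \sum_(j in J) (cup k (J :\ j) (shift [set j] x) * h k (shift (J :\ j) (shift [set j] x))
                 + cup k (J :\ j) x * h k (shift (J :\ j) x)).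
Proof.
rewrite big_split /= [X in _ = X + _](eq_bigr (fun j =>
    cup k (J :\ j) (shift [set j] x) * h k (shift J x))).
  rewrite -big_distrl /= cup_closed big_distrl -big_split /=.
  by apply: eq_bigr => j _; rewrite mulrDr.
by move=> j jJ; rewrite shiftD1.
Qed.

(** All vertices of the cell share the j-th coordinate of [x], so [h m] is constant on it and the
    factor dh_m vanishes. *)
Lemma cup_face k m J j (x : {ffun 'I_n -> nat}) : (m < k)%N -> j \notin J ->
  (forall y : {ffun 'I_n -> nat}, y j = x j -> h m y = h m x) -> cup k J x = 0.
Proof.
elim: k J => [//|k IH] J mk jJ hm /=; apply: big1 => i iJ.
have [mk'|km] := ltnP m k; first by rewrite IH ?mul0r // !inE negb_and jJ orbT.
have -> : k = m by apply/eqP; rewrite eqn_leq km -ltnS mk.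
rewrite !(hm (shift _ _)) ?F2_addrr ?mulr0 // ffunE ?inE (negbTE jJ) ?andbF addn0 //.
Qed.

Lemma cup_neq0 k J x m : (m < k)%N -> cup k J x != 0 ->
  exists A B, h m (shift A x) != h m (shift B x).
Proof.
elim: k J => [//|k IH] J mk /= /eqP s0.
have [j jJ] : exists2 j, j \in J &
    cup k (J :\ j) x * (h k (shift J x) + h k (shift (J :\ j) x)) != 0.
  apply/exists_inP; apply: contra_notT s0; rewrite negb_exists_in => /forall_inP H.
  by apply: big1 => j /H; rewrite negbK => /eqP.
rewrite mulf_eq0 negb_or => /andP[c0 d0].
have [mk'|km] := ltnP m k; first exact: IH c0.
have <- : k = m by apply/eqP; rewrite eqn_leq km -ltnS mk.
by exists J, (J :\ j); apply: contra d0 => /eqP ->; rewrite F2_addrr.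
Qed.

Variable p : nat.
Hypothesis p_odd : odd p.

Lemma F2_odd q : odd q -> q%:R = 1 :> 'F_2.
Proof.
by move=> oq; rewrite -[q]odd_double_half oq natrD -addnn natrD F2_addrr addr0.
Qed.

(* Each value of [F] is counted p times on the right: harmless modulo 2. *)
Lemma sum_update (j : 'I_n) (F : {ffun 'I_n -> 'I_p} -> 'F_2) :
  \sum_x F x =
  \sum_(x : {ffun 'I_n -> 'I_p}) \sum_(m < p) F [ffun i => if i == j then m else x i].
Proof.
rewrite pair_bigA /=.
pose s (u : {ffun 'I_n -> 'I_p} * 'I_p) :=
  ([ffun i => if i == j then u.2 else u.1 i] : {ffun 'I_n -> 'I_p}, u.1 j).
have sK : involutive s.
  case=> x m; rewrite /s /= ffunE eqxx; congr (_, _).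
  by apply/ffunP => i; rewrite !ffunE; case: eqP => // ->.
rewrite [RHS](reindex_inj (inv_inj sK)) /=.
rewrite (eq_bigr (fun u => F u.1)); last first.
  case=> x m _ /=; congr F; apply/ffunP => i; rewrite !ffunE.
  by case: eqP => // ->.
rewrite -(pair_bigA _ (fun x _ => F x)) /=.
by apply: eq_bigr => x _; rewrite sumr_const card_ord -mulr_natr F2_odd ?mulr1.
Qed.

(* The coordinates of [x] outside [J] are ignored, so a sum over [x] counts each
   J-cell p^(n-|J|) times, an odd number. *)
Definition vertex J (x : {ffun 'I_n -> 'I_p}) : {ffun 'I_n -> nat} :=
  [ffun i => if i \in J then x i : nat else p].

(** [sum_update] frees the j-th coordinate; summed over it, the differences telescope from 0 to
    [p]. *)
Lemma sum_telescope J j (e : {ffun 'I_n -> nat} -> 'F_2) : j \in J ->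
  \sum_x (e (shift [set j] (vertex J x)) + e (vertex J x)) =
  \sum_x (e (upd j p (vertex J x)) + e (upd j 0 (vertex J x))).
Proof.
move=> jJ; rewrite (sum_update j); apply: eq_bigr => x _.
pose d m := e (upd j m.+1 (vertex J x)) - e (upd j m (vertex J x)).
rewrite (eq_bigr (fun m : 'I_p => d m)).
  rewrite -(big_mkord xpredT d).
  rewrite telescope_sumr //; congr (_ + _).
  by apply/esym/F2_eq_add; rewrite subrr.
move=> m _; rewrite /d.
have -> z : - z = z :> 'F_2 by apply: F2_eq_add; rewrite addNr.
congr (e _ + e _); apply/ffunP => i; rewrite !ffunE ?inE; case: eqP => [->|_];
  by rewrite ?jJ ?addn0 ?addn1.
Qed.

Hypothesis h0 : forall (j : 'I_n) (x : {ffun 'I_n -> nat}), x j = 0%N -> h j x = 0.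
Hypothesis hp : forall (j : 'I_n) (x : {ffun 'I_n -> nat}), x j = p -> h j x = 1.

(** By [cupS] and [sum_telescope] only faces on the boundary of the grid count. Those with x_j = 0
    or x_j = p for j < k vanish by [cup_face]; in direction k, h_k kills the face x_k = 0 and is 1
    on x_k = p, which leaves the sum for k. *)
Lemma sum_cup k : (k <= n)%N ->
  \sum_x cup k [set i : 'I_n | (i < k)%N] (vertex [set i : 'I_n | (i < k)%N] x) = 1.
Proof.
elim: k => [_|k IH kn].
  rewrite /= sumr_const -mulr_natr mul1r card_ffun !card_ord F2_odd //.
  by rewrite oddX p_odd orbT.
rewrite -(IH (ltnW kn)).
set J := [set i : 'I_n | (i < k.+1)%N]; set J' := [set i : 'I_n | (i < k)%N].
pose jk := Ordinal kn.
have jkJ : jk \in J by rewrite inE /=.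
have JJ' : J :\ jk = J'.
  apply/setP => i; rewrite !inE -val_eqE /= ltnS ltn_neqAle //.
under eq_bigr => x _ do rewrite cupS.
rewrite exchange_big /=.
under eq_bigr => j jJ do rewrite
  (sum_telescope (fun y => cup k (J :\ j) y * h k (shift (J :\ j) y)) jJ).
rewrite (bigD1 jk) //= [X in _ + X]big1 ?addr0.
  apply: eq_bigr => x _; rewrite JJ'.
  have -> : h k (shift J' (upd jk p (vertex J x))) = 1.
    by apply: (@hp jk); rewrite !ffunE eqxx inE ltnn addn0.
  have -> : h k (shift J' (upd jk 0 (vertex J x))) = 0.
    by apply: (@h0 jk); rewrite !ffunE eqxx inE ltnn.
  (* [vertex] puts [p] outside its set of directions, so the face x_k = p of a J-cell is exactly the
     J'-cell of the same [x]. *)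
  rewrite mulr0 mulr1 addr0; congr cup; apply/ffunP => i.
  by rewrite !ffunE -JJ' !inE; case: eqP.
move=> j /andP[jJ jk'].
have jltk : (j < k)%N.
  by move: jJ jk'; rewrite inE ltnS leq_eqVlt -val_eqE /= => /orP[->|].
apply: big1 => x _.
have jn : j \notin J :\ j by rewrite !inE eqxx.
rewrite !(cup_face jltk jn) ?mul0r ?addr0 // => y; rewrite !ffunE eqxx => yj.
  by rewrite !(h0 (j := j)) // ffunE eqxx.
by rewrite !(hp (j := j)) // ffunE eqxx.
Qed.

End Kuhn.

Lemma kuhn n p (h : 'I_n -> {ffun 'I_n -> nat} -> bool) : odd p ->
  (forall j (x : {ffun 'I_n -> nat}), x j = 0%N -> ~~ h j x) ->
  (forall j (x : {ffun 'I_n -> nat}), x j = p -> h j x) ->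
  exists2 x : {ffun 'I_n -> nat}, (forall i, x i < p)%N &
    forall j, exists A B, h j (shift A x) /\ ~~ h j (shift B x).
Proof.
move=> op h0 hp.
(* [cup] takes cochains indexed by all of [nat]; those with index at least [n] are set to 0. *)
pose g m (x : {ffun 'I_n -> nat}) : 'F_2 :=
  if insub m is Some j then (h j x)%:R else 0.
have gE (j : 'I_n) x : g j x = (h j x)%:R by rewrite /g valK.
have S1 := @sum_cup n g p op _ _ n (leqnn n).
have [x x0] : exists x, cup g n [set i : 'I_n | (i < n)%N]
      (@vertex n p [set i : 'I_n | (i < n)%N] x) != 0.
  apply/existsP; apply: contraT; rewrite negb_exists => /forallP H.
  have := oner_neq0 'F_2; rewrite -S1 ?big1 ?eqxx // => [x _|j x xj|j x xj].
  - by apply/eqP; have := H x; rewrite negbK.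
  - by rewrite gE (negbTE (h0 _ _ xj)).
  - by rewrite gE hp.
exists (vertex [set i : 'I_n | (i < n)%N] x) => [i|j].
  by rewrite ffunE inE ltn_ord.
have [A [B]] := cup_neq0 (ltn_ord j) x0; rewrite !gE.
case hA: (h j _); case hB: (h j _); rewrite ?eqxx // => _.
  by exists A, B; rewrite hA hB.
by exists B, A; rewrite hA hB.
Qed.

Local Open Scope classical_set_scope.

(** * Brouwer's theorem on a cube *)

(** A cluster point of an ultrafilter is a limit. One ultrafilter thus replaces successive
    extractions of subsequences. *)
Lemma compact_ultra_cvg (T : Type) (X : topologicalType) (U : set_system T)
    (K : set X) (u : T -> X) :
  UltraFilter U -> compact K -> (forall t, K (u t)) -> exists2 l, K l & u @ U --> l.
Proof.
move=> UU cK Ku.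
have [l [Kl clu]] := cK (u @ U) _ (filterS (fun t _ => Ku t) filterT).
exists l => // B lB; have [//|nB] := in_ultra_setVsetC (u @^-1` B) UU.
by have [y [nBy By]] := clu (~` B) B nB lB.
Qed.

Lemma rV_cvg (T : Type) (F : set_system T) (X : topologicalType) n
    (u : T -> 'rV[X]_n) (l : 'rV[X]_n) : Filter F ->
  (forall j, u t ord0 j @[t --> F] --> l ord0 j) -> u @ F --> l.
Proof.
move=> FF ul A [P lP PA].
have H : \forall t \near F, forall j, P ord0 j (u t ord0 j).
  by apply: filter_forall => j; exact: ul (lP ord0 j).
by apply: filterS H => t Pt; apply: PA => i j; rewrite ord1.
Qed.

Section Limits.
Context {R : realType} {n : nat}.

Lemma coord_cvg (T : Type) (F : set_system T) (u : T -> 'rV[R]_n) (l : 'rV[R]_n) j :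
  Filter F -> u @ F --> l -> u t ord0 j @[t --> F] --> l ord0 j.
Proof. by move=> FF ul B lB; exact: ul _ (@coord_continuous R 1 n ord0 j l B lB). Qed.

Lemma cvg_harmonic_close (U : set_system nat) (b y : nat -> 'rV[R]_n) (l : 'rV[R]_n)
    (C : R) :
  ProperFilter U -> \oo `<=` U ->
  (forall N j, `|y N ord0 j - b N ord0 j| <= C * harmonic N) ->
  b @ U --> l -> y @ U --> l.
Proof.
move=> PU oU yb bl; apply: rV_cvg => j.
have hU : (fun N => C * @harmonic R N) @ U --> (0 : R).
  rewrite -(mulr0 C); apply: cvgM; first exact: cvg_cst.
  by apply: cvg_trans cvg_harmonic => A /= hA; exact: oU.
rewrite (_ : (fun N => _) = (fun N => b N ord0 j + (y N ord0 j - b N ord0 j))).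
  rewrite -[X in _ --> X]addr0; apply: cvgD; first exact: coord_cvg.
  apply: (squeeze_cvgr (f := fun N => - (C * harmonic N))
    (h := fun N => C * harmonic N)) => //.
    by near=> N; rewrite -ler_norml.
  by rewrite -oppr0; exact: cvgN.
by apply/funext => N; rewrite addrC subrK.
Unshelve. all: by end_near. Qed.

End Limits.

Definition box {R : realType} {n} (a : 'rV[R]_n) (L : R) : set 'rV[R]_n :=
  [set x | forall j, a ord0 j <= x ord0 j <= a ord0 j + L].

Definition grid {R : realType} {n} (a : 'rV[R]_n) (L : R) p (v : 'I_n -> nat)
  : 'rV[R]_n := \row_j (a ord0 j + L * ((v j)%:R / p%:R)).

Section Brouwer.
Context {R : realType} {n : nat} (a : 'rV[R]_n) (L : R).
Hypothesis L0 : 0 <= L.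

Lemma box_compact : compact (box a L).
Proof.
have := @rV_compact R n (fun j => `[a ord0 j, a ord0 j + L]%classic).
rewrite (_ : [set v | _] = box a L); last first.
  by apply/seteqP; split => x /= H j; have := H j; rewrite in_itv.
by apply => j; exact: segment_compact.
Qed.

Lemma grid_box p (v : 'I_n -> nat) : (0 < p)%N -> (forall i, v i <= p)%N ->
  box a L (grid a L p v).
Proof.
move=> p0 vp j; rewrite mxE lerDl lerD2l mulr_ge0 ?divr_ge0 ?ler0n //=.
by rewrite ler_piMr // ler_pdivrMr ?ltr0n // mul1r ler_nat.
Qed.

Lemma grid_shift p A x j :
  `|grid a L p (shift A x) ord0 j - grid a L p x ord0 j| <= L / p%:R.
Proof.
rewrite !mxE opprD addrACA subrr add0r -mulrBr -mulrBl ffunE natrD.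
rewrite [_ + _%:R]addrC addrK normrM (ger0_norm L0) ler_wpM2l //.
rewrite normrM ger0_norm ?ler0n // ger0_norm ?invr_ge0 ?ler0n //.
by case: (_ \in _); rewrite ?mul1r // mul0r invr_ge0 ler0n.
Qed.

Lemma grid_cell (G : 'rV[R]_n -> 'rV[R]_n) p : odd p ->
  (forall x, box a L x -> box a L (G x)) ->
  exists x, box a L x /\ forall j, exists y z,
    [/\ box a L y, box a L z,
     G y ord0 j <= y ord0 j, z ord0 j <= G z ord0 j &
     forall k, `|y ord0 k - x ord0 k| <= L / p%:R /\ `|z ord0 k - x ord0 k| <= L / p%:R].
Proof.
move=> op GB; have p0 : (0 < p)%N by case: p op.
pose g := grid a L p.
(* The label records that [G] does not increase coordinate [j]. The two clauses on [v j] force the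
   boundary values that [kuhn] asks for; on those faces the wanted inequality holds anyway, since
   [G] stays in the box. *)
pose h (j : 'I_n) (v : {ffun 'I_n -> nat}) :=
  (0 < v j)%N && ((p <= v j)%N || (G (g v) ord0 j <= g v ord0 j)).
have [||x xp hx] := @kuhn n p h op.
- by move=> j v vj; rewrite /h vj.
- by move=> j v vj; rewrite /h vj p0 leqnn.
have sB A : box a L (g (shift A x)).
  apply: grid_box => // i; rewrite ffunE.
  by case: (_ \in _); rewrite ?addn1 ?addn0 // ltnW.
exists (g x); split; first by apply: grid_box => // i; exact: ltnW.
move=> j; have [A [B [hA hB]]] := hx j.
exists (g (shift A x)), (g (shift B x)); split => // [||k]; last first.
- by split; exact: grid_shift.
- move: hB; rewrite /h negb_and -leqNgt leqn0 negb_or => /orP[/eqP v0|/andP[_]].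
    have /andP[+ _] := GB _ (sB B) j; apply: le_trans.
    by rewrite mxE v0 mul0r mulr0 addr0.
  by rewrite -ltNge => /ltW.
- move: hA; rewrite /h => /andP[_ /orP[pv|//]].
  have /andP[_] := GB _ (sB A) j; move/le_trans; apply.
  rewrite mxE lerD2l ler_peMr // ler_pdivlMr ?ltr0n // mul1r ler_nat //.
Qed.

Lemma brouwer_box (G : 'rV[R]_n -> 'rV[R]_n) :
  {within box a L, continuous G} ->
  (forall x, box a L x -> box a L (G x)) ->
  exists2 x, box a L x & G x = x.
Proof.
move=> /subspace_continuousP cG GB.
pose P N x (y z : 'I_n -> 'rV[R]_n) := box a L x /\ forall j,
  [/\ box a L (y j), box a L (z j), G (y j) ord0 j <= y j ord0 j,
     z j ord0 j <= G (z j) ord0 j &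
     forall k, `|y j ord0 k - x ord0 k| <= L * harmonic N /\
               `|z j ord0 k - x ord0 k| <= L * harmonic N].
have cell N : exists x y z, P N x y z.
  (* The odd subdivision 2N+1 meets the parity condition of [kuhn], and its mesh is at most
     [L * harmonic N]. *)
  have oN : odd N.*2.+1 by rewrite /= odd_double.
  have [x [Bx]] := grid_cell oN GB.
  move=> /choice[y /choice[z H]]; exists x, y, z; split => // j.
  have [? ? ? ? close] := H j; split => // k.
  have le : L / N.*2.+1%:R <= L * harmonic N.
    by rewrite ler_wpM2l // lef_pV2 ?posrE ?ltr0n // ler_nat ltnS -addnn leq_addr.
  by have [yk zk] := close k; split; apply: le_trans le.
have [x /choice[y /choice[z H]]] := choice cell.
have [U [UU oU]] := ultraFilterLemma (F := \oo) _.
have [l Bl xl] := compact_ultra_cvg UU box_compact (fun N => (H N).1).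
exists l => //; apply/rowP => j.
have lim (w : nat -> 'rV[R]_n) : (forall N, box a L (w N)) ->
    (forall N k, `|w N ord0 k - x N ord0 k| <= L * harmonic N) ->
    w N ord0 j @[N --> U] --> l ord0 j /\ G (w N) ord0 j @[N --> U] --> G l ord0 j.
  move=> Bw wx; have wl : w @ U --> l by apply: (cvg_harmonic_close _ oU wx).
  split; first exact: coord_cvg.
  apply: coord_cvg => A /(cG l Bl) /wl HA.
  by apply: (@filterS _ U _ _ _ _ HA) => N /=; apply; exact: Bw.
have [||yl Gyl] := lim (fun N => y N j); first by move=> N; have [] := (H N).2 j.
  by move=> N k; have [_ _ _ _ /(_ k)[]] := (H N).2 j.
have [||zl Gzl] := lim (fun N => z N j); first by move=> N; have [] := (H N).2 j.
  by move=> N k; have [_ _ _ _ /(_ k)[]] := (H N).2 j.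
apply/eqP; rewrite eq_le; apply/andP; split.
  apply: ler_cvg_to Gyl yl _; near=> N; by have [] := (H N).2 j.
apply: ler_cvg_to zl Gzl _; near=> N; by have [] := (H N).2 j.
Unshelve. all: by end_near. Qed.
End Brouwer.

(** * Coloured partitions of unity *)

(** The third condition forbids w - v from taking both values 1 and -1, so one may assume v <= w.
    Then the entries of w - v are 0 or 1, their sum is at most n and divisible by n+1, hence 0. *)
Lemma eq_of_sum_mod n (v w : 'I_n -> nat) :
  (forall j, v j <= w j + 1)%N -> (forall j, w j <= v j + 1)%N ->
  (forall j k, v j + w k <= w j + v k + 1)%N ->
  (\sum_j v j = \sum_j w j %[mod n.+1])%N -> v =1 w.
Proof.
wlog le_vw : v w / forall j, (v j <= w j)%N.
  move=> H vw wv vwvw E.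
  have [/forallP le|] := boolP [forall j, (v j <= w j)%N]; first exact: (H v w).
  rewrite negb_forall => /existsP[j]; rewrite -ltnNge => wvj k.
  apply/esym; apply: (H w v) => // i; last by move=> i'; have := vwvw i' i; lia.
  by have := vwvw j i; lia.
move=> _ wv _ E.
have Ew : (\sum_j w j = \sum_j v j + \sum_j (w j - v j))%N.
  by rewrite -big_split /=; apply: eq_bigr => j _; rewrite subnKC.
have le_n : (\sum_j (w j - v j) <= n)%N.
  rewrite -[X in (_ <= X)%N]card_ord -sum1_card.
  by apply: leq_sum => j _; have := wv j; lia.
have : (\sum_j (w j - v j) = 0)%N.
  have : (\sum_j v j + 0 == \sum_j v j + \sum_j (w j - v j) %[mod n.+1])%N.
    by rewrite addn0 -Ew; apply/eqP.
  by rewrite eqn_modDl mod0n modn_small ?ltnS // eq_sym => /eqP.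
move=> /eqP; rewrite sum_nat_eq0 => /forallP d0 j.
by have := d0 j; have := le_vw j; rewrite implyTb; lia.
Qed.

Lemma cvg_maxr (R : realType) (T : Type) (F : set_system T) (f g : T -> R) (l m : R) :
  Filter F -> f @ F --> l -> g @ F --> m ->
  Num.max (f t) (g t) @[t --> F] --> Num.max l m.
Proof.
move=> FF fl gm; rewrite maxr_absE; under eq_cvg => t do rewrite maxr_absE.
apply: cvgM; [apply: cvgD; first exact: cvgD|exact: cvg_cst].
by apply: cvg_norm; exact: cvgB.
Qed.

Section Hat.
Context {R : realType} {n : nat} (a : 'rV[R]_n) (L : R) (p : nat).
Hypotheses (L0 : 0 < L) (p0 : (0 < p)%N).

Definition rescale (v : 'I_n -> nat) (x : 'rV[R]_n) (j : 'I_n) : R :=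
  p%:R * (x ord0 j - a ord0 j) / L - (v j)%:R.

(* Vanishes unless the numbers 0 and [rescale v x j] all lie within distance < 1
   of one another: the interior of the star of [v] in the Kuhn triangulation. *)
Definition hat v x : R :=
  \prod_j (Num.max 0 (1 - rescale v x j) * Num.max 0 (1 + rescale v x j) *
           \prod_k Num.max 0 (1 - (rescale v x j - rescale v x k))).

Lemma hat_ge0 v x : 0 <= hat v x.
Proof.
apply: prodr_ge0 => j _; rewrite !mulr_ge0 ?le_max ?lexx //.
by apply: prodr_ge0 => k _; rewrite le_max lexx.
Qed.

Lemma max0_neq0 (t : R) : (Num.max 0 t != 0) = (0 < t).
Proof. by case: ltrgt0P => //; rewrite ?eqxx // => /gt_eqF ->. Qed.

Lemma hat_neq0P v x : reflect
  (forall j, [/\ rescale v x j < 1, -1 < rescale v x j &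
              forall k, rescale v x j - rescale v x k < 1]) (hat v x != 0).
Proof.
apply: (iffP idP) => [/prodf_neq0 H j|H].
  have := H j isT; rewrite !mulf_eq0 !negb_or !max0_neq0 !subr_gt0 => /andP[/andP[-> h]].
  move=> /prodf_neq0 H'; split => // [|k]; first by rewrite -subr_gt0 opprK addrC.
  by have := H' k isT; rewrite max0_neq0 subr_gt0.
apply/prodf_neq0 => j _; have [h1 h2 h3] := H j.
rewrite !mulf_eq0 !negb_or !max0_neq0 !subr_gt0 h1 -[X in 0 < X]addrC -[X in _ + X]opprK.
rewrite subr_gt0 h2 /=.
by apply/prodf_neq0 => k _; rewrite max0_neq0 subr_gt0.
Qed.

Lemma hat_cvg (T : Type) (F : set_system T) (u : T -> 'rV[R]_n) (x : 'rV[R]_n) v :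
  Filter F -> u @ F --> x -> hat v (u t) @[t --> F] --> hat v x.
Proof.
move=> FF ux.
have rc j : rescale v (u t) j @[t --> F] --> rescale v x j.
  apply: cvgB; last exact: cvg_cst.
  apply: cvgM; last exact: cvg_cst.
  apply: cvgM; first exact: cvg_cst.
  apply: cvgB; last exact: cvg_cst.
  exact: coord_cvg.
have mc (g : T -> R) (l : R) : g t @[t --> F] --> l ->
    Num.max 0 (g t) @[t --> F] --> Num.max 0 l.
  by move=> gl; apply: cvg_maxr => //; exact: cvg_cst.
apply: cvg_big => [|j _]; first exact: mul_continuous.
apply: cvgM.
  apply: cvgM; apply: mc.
    by apply: cvgB => //; exact: cvg_cst.
  by apply: cvgD => //; exact: cvg_cst.
apply: cvg_big => [|k _]; first exact: mul_continuous.
apply: mc; apply: cvgB; first exact: cvg_cst.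
exact: cvgB.
Qed.

Lemma hat_grid v x j : hat v x != 0 -> `|grid a L p v ord0 j - x ord0 j| <= L / p%:R.
Proof.
move=> /hat_neq0P /(_ j)[h1 h2 _].
have pR : 0 < p%:R :> R by rewrite ltr0n.
have -> : grid a L p v ord0 j - x ord0 j = - rescale v x j * (L / p%:R).
  by rewrite mxE /rescale; field; rewrite !gt_eqF.
have Lp : 0 <= L / p%:R by rewrite divr_ge0 // ltW.
by rewrite normrM normrN [X in _ * X]ger0_norm // ler_piMl // ltW // ltr_norml h2.
Qed.

Lemma hat_inj v w x : hat v x != 0 -> hat w x != 0 ->
  (\sum_j v j = \sum_j w j %[mod n.+1])%N -> v =1 w.
Proof.
move=> /hat_neq0P hv /hat_neq0P hw; apply: eq_of_sum_mod => j.
(* [x] drops out of differences of [rescale] values; two strict bounds by 1 add up to an integer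
   below 2, hence at most 1. *)
- have [h1 h2 _] := hv j; have [h3 h4 _] := hw j.
  rewrite -ltnS -(ltr_nat R) -addn1 !natrD; rewrite /rescale in h1 h2 h3 h4; lra.
- have [h1 h2 _] := hv j; have [h3 h4 _] := hw j.
  rewrite -ltnS -(ltr_nat R) -addn1 !natrD; rewrite /rescale in h1 h2 h3 h4; lra.
- move=> k; have [_ _ /(_ j) h1] := hv k; have [_ _ /(_ k) h2] := hw j.
  rewrite -ltnS -(ltr_nat R) -addn1 !natrD; rewrite /rescale in h1 h2; lra.
Qed.

(** Rounding the scaled coordinates down puts every [rescale] value in [0, 1), where all factors of
    [hat] are positive. The value [p] can occur on the upper faces, hence ['I_p.+1]. *)
Lemma hat_cover x : box a L x -> 
  exists v : {ffun 'I_n -> 'I_p.+1}, hat (@nat_of_ord _ \o v) x != 0.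
Proof.
move=> Bx; pose s j := p%:R * (x ord0 j - a ord0 j) / L.
have s0 j : 0 <= s j.
  by have /andP[h _] := Bx j; rewrite !mulr_ge0 ?invr_ge0 ?subr_ge0 // ltW.
have sp j : s j <= p%:R.
  have /andP[_ h] := Bx j; rewrite /s -mulrA ler_piMr // ler_pdivrMr // mul1r.
  by rewrite lerBlDl.
have tp j : (Num.truncn (s j) < p.+1)%N.
  rewrite ltnS -(ler_nat R) (le_trans _ (sp j)) //.
  by have /andP[] := truncn_itv (s0 j).
exists [ffun j => Ordinal (tp j)].
have r01 j : 0 <= rescale (@nat_of_ord _ \o [ffun j => Ordinal (tp j)]) x j < 1.
  rewrite /rescale /= ffunE -/(s j) subr_ge0 ltrBlDr nat1r.
  exact: truncn_itv.
by apply/hat_neq0P => j; split => [||k]; have := r01 j; try have := r01 k; lra.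
Qed.

End Hat.

Lemma box_convex {R : realType} {n : nat} (a : 'rV[R]_n) (L : R) (I : finType)
    (t : I -> R) (g : I -> 'rV[R]_n) :
  (forall i, 0 <= t i) -> \sum_i t i = 1 -> (forall i, box a L (g i)) ->
  box a L (\sum_i t i *: g i).
Proof.
move=> t0 t1 Bg j; rewrite summxE.
apply/andP; split; [rewrite -[leLHS]mul1r|rewrite -[leRHS]mul1r]; rewrite -t1 mulr_suml;
  by apply: ler_sum => i _; rewrite mxE ler_wpM2l //; have /andP[] := Bg i j.
Qed.

Definition colour {n p} (v : {ffun 'I_n -> 'I_p.+1}) : 'I_n.+1 :=
  Ordinal (ltn_pmod (\sum_j v j) (ltn0Sn n)).

Lemma coloured_fixpoint {R : realType} {n : nat} (a : 'rV[R]_n) (L : R) (p : nat)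
    (g : {ffun 'I_n -> 'I_p.+1} -> 'rV[R]_n) :
  0 < L -> (0 < p)%N -> (forall v, box a L (g v)) ->
  exists x (t : {ffun 'I_n -> 'I_p.+1} -> R),
    [/\ box a L x, forall v, 0 <= t v, \sum_v t v = 1, x = \sum_v t v *: g v &
     (forall v, t v != 0 -> forall j,
        `|grid a L p (@nat_of_ord _ \o v) ord0 j - x ord0 j| <= L / p%:R) /\
     (forall u v, t u != 0 -> t v != 0 -> colour u = colour v -> u = v)].
Proof.
move=> L0 p0 Bg.
pose w (v : {ffun 'I_n -> 'I_p.+1}) x := hat a L p (@nat_of_ord _ \o v) x.
pose s x := \sum_(v : {ffun 'I_n -> 'I_p.+1}) w v x.
pose G x : 'rV[R]_n := \sum_(v : {ffun 'I_n -> 'I_p.+1}) (w v x / s x) *: g v.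
have w0 v x : 0 <= w v x by exact: hat_ge0.
have s0 x : box a L x -> s x != 0.
  move=> /(hat_cover p L0)[v wv]; rewrite psumr_neq0 //.
  by apply/hasP; exists v; rewrite ?mem_index_enum // lt_def w0 andbT.
have t0 x v : 0 <= w v x / s x by rewrite divr_ge0 // sumr_ge0.
have t1 x : box a L x -> \sum_v w v x / s x = 1.
  by move=> Bx; rewrite -mulr_suml divff // s0.
(* Continuity is claimed only at points of the box: there [hat_cover] keeps the denominator [s] away
   from 0. *)
have Gc (F : set_system 'rV[R]_n) x : Filter F -> F --> x -> box a L x ->
    G y @[y --> F] --> G x.
  move=> FF Fx Bx.
  have wc v : w v y @[y --> F] --> w v x by exact: (@hat_cvg R n a L p _ F id).
  apply: cvg_big => [|v _]; first exact: add_continuous.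
  apply: cvgZ; last exact: cvg_cst.
  apply: cvgM => //; apply: cvgV; first exact: s0.
  by apply: cvg_big => [|u _]; [exact: add_continuous|exact: wc].
have [||x Bx Gx] := @brouwer_box R n a L (ltW L0) G.
- apply/subspace_continuousP => x Bx.
  by apply: Gc => //; exact: cvg_within.
- by move=> x Bx; apply: box_convex => //; exact: t1.
have tw v : w v x / s x != 0 -> w v x != 0.
  by apply: contra => /eqP ->; rewrite mul0r.
exists x, (fun v => w v x / s x); split => //; first exact: t1.
split => [v /tw|u v /tw wu /tw wv [uv]]; first by move=> wv j; exact: hat_grid.
have E : (@nat_of_ord _ \o u) =1 (@nat_of_ord _ \o v).
  exact: hat_inj wu wv uv.
by apply/ffunP => j; apply/val_inj; exact: E.
Qed.

(** * The ball and the limit *)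

(** The difference of the two sides is the variance of [b] under the weights [t]. *)
Lemma sqr_sum_le {R : realType} (I : finType) (t b : I -> R) :
  (forall i, 0 <= t i) -> \sum_i t i = 1 ->
  (\sum_i t i * b i) ^+ 2 <= \sum_i t i * b i ^+ 2.
Proof.
move=> t0 t1; set m := \sum_i t i * b i.
have : 0 <= \sum_i t i * (b i - m) ^+ 2.
  by apply: sumr_ge0 => i _; rewrite mulr_ge0 ?sqr_ge0.
rewrite (eq_bigr (fun i => t i * b i ^+ 2 + (- (2 * m) * (t i * b i) + m ^+ 2 * t i))).
  by rewrite !big_split /= -!mulr_sumr -/m t1; nra.
by move=> i _; ring.
Qed.

Section Ball.
Context {R : realType} {n : nat} (c : 'rV[R]_n) (r : R).
Hypothesis r0 : 0 < r.

Lemma eball_box : eball c r `<=` box (c - const_mx r) (r *+ 2).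
Proof.
move=> x Bx j; rewrite !mxE.
suff : `|x ord0 j - c ord0 j| <= r by rewrite ler_norml; lra.
rewrite -(@ler_pXn2r _ 2) ?nnegrE ?(ltW r0) // real_normK ?num_real //.
apply: le_trans Bx; rewrite (bigD1 j) //= lerDl.
by apply: sumr_ge0 => i _; exact: sqr_ge0.
Qed.

Lemma eball_convex (I : finType) (t : I -> R) (g : I -> 'rV[R]_n) :
  (forall i, 0 <= t i) -> \sum_i t i = 1 -> (forall i, eball c r (g i)) ->
  eball c r (\sum_i t i *: g i).
Proof.
move=> t0 t1 Bg; rewrite /eball /=.
apply: (@le_trans _ _ (\sum_i t i * \sum_j (g i ord0 j - c ord0 j) ^+ 2)).
  under [leRHS]eq_bigr => i _ do rewrite mulr_sumr.
  rewrite exchange_big /=; apply: ler_sum => j _.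
  rewrite (_ : _ - _ = \sum_i t i * (g i ord0 j - c ord0 j)); first exact: sqr_sum_le.
  under [RHS]eq_bigr => i _ do rewrite mulrBr.
  rewrite sumrB -mulr_suml t1 mul1r summxE; congr (_ - _).
  by apply: eq_bigr => i _; rewrite mxE.
rewrite -[leRHS]mul1r -t1 mulr_suml; apply: ler_sum => i _.
by rewrite ler_wpM2l //; exact: Bg.
Qed.

Definition sqdist (x : 'rV[R]_n) : R := \sum_j (x ord0 j - c ord0 j) ^+ 2.

(* Not the nearest-point retraction: the factor r^2 / |x - c|^2 avoids a square
   root at the price of mapping exterior points inside the ball. *)
Definition retract (x : 'rV[R]_n) : 'rV[R]_n :=
  c + (r ^+ 2 / Num.max (r ^+ 2) (sqdist x)) *: (x - c).

Lemma retract_eball x : eball c r (retract x).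
Proof.
rewrite /eball /= /retract; set m := Num.max _ _.
have rm : r ^+ 2 <= m by rewrite le_max lexx.
have m0 : 0 < m by apply: lt_le_trans rm; rewrite exprn_gt0.
have -> : \sum_j ((c + (r ^+ 2 / m) *: (x - c)) ord0 j - c ord0 j) ^+ 2
    = (r ^+ 2 / m) ^+ 2 * sqdist x.
  rewrite mulr_sumr; apply: eq_bigr => j _.
  by rewrite !mxE addrC addKr exprMn.
(* As [m] dominates both [sqdist x] and r^2, the squared distance is at most r^4 / m <= r^2. *)
apply: (@le_trans _ _ ((r ^+ 2 / m) ^+ 2 * m)).
  by rewrite ler_wpM2l ?sqr_ge0 // le_max lexx orbT.
rewrite expr2 mulrA divfK ?gt_eqF // mulrAC -expr2 ler_pdivrMr //.
by rewrite ler_wpM2l ?sqr_ge0.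
Qed.

Lemma retract_id x : eball c r x -> retract x = x.
Proof.
move=> Bx; rewrite /retract max_l // divff ?scale1r 1?addrC ?subrK //.
by rewrite gt_eqF // exprn_gt0.
Qed.

Lemma retract_cvg (T : Type) (F : set_system T) (u : T -> 'rV[R]_n) (x : 'rV[R]_n) :
  Filter F -> u @ F --> x -> retract (u t) @[t --> F] --> retract x.
Proof.
move=> FF ux; apply: cvgD; first exact: cvg_cst.
apply: cvgZ; last by apply: cvgB => //; exact: cvg_cst.
apply: cvgM; first exact: cvg_cst.
apply: cvgV; first by rewrite gt_eqF // lt_max exprn_gt0.
apply: cvg_maxr; first exact: cvg_cst.
apply: cvg_big => [|j _]; first exact: add_continuous.
have d : u t ord0 j - c ord0 j @[t --> F] --> x ord0 j - c ord0 j.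
  by apply: cvgB; [exact: coord_cvg|exact: cvg_cst].
by rewrite expr2; under eq_cvg => t do rewrite expr2; exact: cvgM.
Qed.

(** The fixed point of the averaged map is regrouped by colour: each colour has at most one grid
    point of nonzero weight, so its share of the sum is a multiple of a single value of [f i]. *)
Lemma approx_join (f : 'I_n.+1 -> 'rV[R]_n -> set 'rV[R]_n) N :
  (forall i x, eball c r x -> f i x !=set0) ->
  (forall i x, eball c r x -> f i x `<=` eball c r) ->
  exists x (t : 'I_n.+1 -> R) (b q : 'I_n.+1 -> 'rV[R]_n),
    [/\ box (c - const_mx r) (r *+ 2) x, forall i, 0 <= t i <= 1,
        \sum_i t i = 1, x = \sum_i t i *: b i &
        forall i, f i (retract (q i)) (b i) /\
          forall j, `|q i ord0 j - x ord0 j| <= r *+ 2 * harmonic N].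
Proof.
move=> f0 fB; set L := r *+ 2.
have L0 : 0 < L by rewrite pmulrn_rgt0.
(* With N+1 subdivisions the mesh is exactly [L * harmonic N]. *)
pose pt (v : {ffun 'I_n -> 'I_N.+2}) := grid (c - const_mx r) L N.+1 (@nat_of_ord _ \o v).
have /choice[g fg] v : exists b, f (colour v) (retract (pt v)) b.
  exact/f0/retract_eball.
have Bg v : box (c - const_mx r) L (g v).
  by apply/eball_box/(fB _ _ _ _ (fg v))/retract_eball.
have [x [t [Bx t0 t1 xE [near_x inj]]]] := coloured_fixpoint L0 (ltn0Sn N) Bg.
pose T i := \sum_(v | colour v == i) t v.
have T0 i : 0 <= T i by rewrite sumr_ge0.
have T1 : \sum_i T i = 1 by rewrite -t1 (partition_big (@colour n N.+1) xpredT).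
have /choice[bq H] i : exists bq : 'rV[R]_n * 'rV[R]_n,
    [/\ f i (retract bq.2) bq.1,
        forall j, `|bq.2 ord0 j - x ord0 j| <= L * harmonic N &
        \sum_(v | colour v == i) t v *: g v = T i *: bq.1].
  have [[v [/eqP vi tv]]|no] := pselect (exists v, colour v = i /\ t v != 0).
    have tu u : (colour u == i) && (u != v) -> t u = 0.
      move=> /andP[/eqP ui uv]; apply/eqP; apply: contraNT uv => tu0; apply/eqP.
      by apply: inj => //; rewrite ui (eqP vi).
    exists (g v, pt v); split => /= [|j|]; first by have := fg v; rewrite (eqP vi).
      exact: near_x.
    rewrite /T (bigD1 v) //= [X in _ = X *: _](bigD1 v) //=.
    by rewrite !big1 ?addr0 // => u /tu ->; rewrite scale0r.
  (* A colour without active grid points has weight 0; any value of [f i] at [retract x] then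
     serves, with [q i] equal to [x]. *)
  have tu u : colour u == i -> t u = 0.
    by move=> /eqP ui; apply/eqP; apply: contra_notT no => tu0; exists u.
  have [b fb] := f0 i _ (retract_eball x).
  exists (b, x); split => //= [j|].
    by rewrite subrr normr0 mulr_ge0 ?ltW // harmonic_gt0.
  by rewrite /T !big1 ?scale0r // => u /tu ->; rewrite scale0r.
exists x, T, (fun i => (bq i).1), (fun i => (bq i).2); split => // [i||i].
- by rewrite T0 -T1 (bigD1 i) //= lerDl sumr_ge0.
- rewrite {1}xE (partition_big (@colour n N.+1) xpredT) //=.
  by apply: eq_bigr => i _; have [] := H i.
- by have [] := H i.
Qed.

End Ball.

Theorem theorem5p4 (R : realType) (n : nat) (c : 'rV[R]_n) (r : R)
  (f : 'I_n.+1 -> 'rV[R]_n -> set 'rV[R]_n) :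
  0 < r ->
  (forall i x, eball c r x -> f i x !=set0) ->
  (forall i x, eball c r x -> f i x `<=` eball c r) ->
  (forall i, closed (sgraph (eball c r) (f i))) ->
  exists x, eball c r x /\ gjoin (fun i => f i x) x.
Proof.
move=> r0 f0 fB fcl.
have approx N := approx_join r0 N f0 fB.
have [x /choice[t /choice[b /choice[q H]]]] := choice approx.
have [U [UU oU]] := ultraFilterLemma (F := \oo) _.
have Bb i N : eball c r (b N i).
  have [_ _ _ _ /(_ i)[fb _]] := H N.
  by apply: fB fb; exact: retract_eball.
have L0 : 0 <= r *+ 2 by rewrite mulrn_wge0 // ltW.
have [y _ xy] : exists2 y, box (c - const_mx r) (r *+ 2) y & x @ U --> y.
  by apply: compact_ultra_cvg => [|N]; [exact: box_compact|have [] := H N].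
have /choice[s st] : forall i, exists s : R, t N i @[N --> U] --> s.
  move=> i.
  have [s _ ?] : exists2 s : R, (`[0, 1]%classic : set R) s & t N i @[N --> U] --> s.
    apply: compact_ultra_cvg; first exact: segment_compact.
    by move=> N; have [_ /(_ i) ? _ _ _] := H N; rewrite /= in_itv.
  by exists s.
have /choice[a ba] : forall i, exists a : 'rV[R]_n, b N i @[N --> U] --> a.
  move=> i.
  have [a _ ?] : exists2 a, box (c - const_mx r) (r *+ 2) a & b N i @[N --> U] --> a.
    by apply: compact_ultra_cvg => [|N]; [exact: box_compact|exact: eball_box].
  by exists a.
have qy i : q N i @[N --> U] --> y.
  apply: (cvg_harmonic_close (C := r *+ 2) _ oU _ xy) => N j.
  by have [_ _ _ _ /(_ i)[_ ]] := H N; apply.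
(* Membership of [y] in the ball is established only below, so the graph point is taken over
   [retract c r y]. *)
have G i : sgraph (eball c r) (f i) (retract c r y, a i).
  have rq : retract c r (q N i) @[N --> U] --> retract c r y by apply: retract_cvg (qy i).
  apply: (closed_cvg (F := U) (u_ := fun N => (retract c r (q N i), b N i)) _ (fcl i)).
    apply: nearW => N; have [_ _ _ _ /(_ i)[fb _]] := H N.
    by split => /=; [exact: retract_eball|split].
  exact: cvg_pair rq (ba i).
have s0 i : 0 <= s i.
  apply: (closed_cvg (F := U) (u_ := fun N => t N i) _ (@closed_ge R 0)) (st i).
  by apply: nearW => N; have [_ /(_ i)/andP[]] := H N.
have s1 : \sum_i s i = 1.
  have st1 : \sum_i t N i @[N --> U] --> \sum_i s i.
    by apply: cvg_big => [|i _]; [exact: add_continuous|exact: st].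
  apply: (closed_cvg (F := U) (u_ := fun N => \sum_i t N i) _ (@closed_eq R 1)) st1.
  by apply: nearW => N; have [] := H N.
have yE : y = \sum_i s i *: a i.
  apply: (cvg_unique _ xy) => //.
  have -> : x = fun N => \sum_i t N i *: b N i.
    by apply/funext => N; have [] := H N.
  apply: cvg_big => [|i _]; first exact: add_continuous.
  by apply: cvgZ; [exact: st|exact: ba].
(* A convex combination of the points [a i] of the ball lies in the ball, so [retract] fixes [y]. *)
have By : eball c r y.
  by rewrite yE; apply: eball_convex => // i; have [_ []] := G i.
exists y; split => //; exists s, a; split => //; split => //; split => // i.
by have [_ [_]] := G i; rewrite retract_id.
Qed.
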